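(* Let $(R,\Phi)$ be a form ring for which the Weight Enumerator Conjecture holds, let $\rho=(V,\rho_M,\rho_\Phi,\beta)$ be a finite representation of $(R,\Phi)$, and let $N\ge1$. Let $C_1,\ldots,C_{t_N}$ be a complete list of the self-dual isotropic codes in $\rho^{(N,N)}$. Then $$\big(\varphi(\mathrm{fwe}^{(N,N)}(C_1)),\ldots,\varphi(\mathrm{fwe}^{(N,N)}(C_{t_N}))\big)$$ is a generating set of the $\mathbb C$-vector space $\mathrm{End}_{\mathcal C(\rho)}(\mathbb CV^N)$, the algebra of endomorphisms of $\mathbb CV^N=\otimes^N\mathbb CV$ commuting with the diagonal action of the Clifford-Weil group $\mathcal C(\rho)$.
   Context: **Form rings.** For a ring $R$ (unital, associative), an $R$-qmodule is an abelian group $\Phi$ with a map $[\,]:R\to\mathrm{End}_{\mathbb Z}(\Phi)$ (written on the right, $\phi\mapsto\phi[r]$) that is pointed quadratic ($[0]=0$ and $(r,s)\mapsto[r+s]-[r]-[s]$ is biadditive) with $[1]=1$, $[rs]=[r][s]$. A right $R\otimes R$-module $M$ is a qmodule via $m[r]=m(r\otimes r)$; qmodule homomorphisms are additive maps commuting with all $[r]$. A form ring $(R,M,\psi,\Phi)$ consists of a ring $R$, a right $R\otimes R$-module $M$, an isomorphism of right $R$-modules $\psi:R_R\to M_{1\otimes R}$, an additive involution $\tau:M\to M$ with $\tau(m)(s\otimes r)=\tau(m(r\otimes s))$ such that $\psi^{-1}(\tau(\psi(1)))$ is a unit of $R$, an $R$-qmodule $\Phi$, and qmodule homomorphisms $\{\!\{\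 \}\!\}:M\to\Phi$, $\lambda:\Phi\to M$ with $\{\!\{\tau(m)\}\!\}=\{\!\{m\}\!\}$, $\tau(\lambda(\phi))=\lambda(\phi)$, $\lambda(\{\!\{m\}\!\})=m+\tau(m)$, $\{\!\{\lambda(\phi)(r\otimes s)\}\!\}=\phi[r+s]-\phi[r]-\phi[s]$. It is abbreviated $(R,\Phi)$. The map $r^J:=\psi^{-1}(\psi(1)(r\otimes1))$ is an anti-automorphism of $R$. **Representations.** A finite representation $\rho=(V,\rho_M,\rho_\Phi,\beta)$ of $(R,\Phi)$ consists of a finite left $R$-module $V$; an $R\otimes R$-module homomorphism $\rho_M$ from $M$ to the group $\mathrm{Bil}(V)$ of biadditive maps $V\times V\to\mathbb Q/\mathbb Z$ (where $(b(r\otimes s))(x,y)=b(rx,sy)$) with $\rho_M(\tau(m))(x,y)=\rho_M(m)(y,x)$ and such that $\beta:=\rho_M(\psi(1))$ is non-singular; and a qmodule homomorphism $\rho_\Phi$ from $\Phi$ to the group of $\mathbb Q/\mathbb Z$-valued (pointed) quadratic maps on $V$ (where $(q[r])(x)=q(rx)$) with $\rho_\Phi(\{\!\{m\}\!\})(x)=\rho_M(m)(x,x)$ and $\rho_M(\lambda(\phi))(x,y)=\rho_\Phi(\phi)(x+y)-\rho_\Phi(\phi)(x)-\rho_\Phi(\phi)(y)$. **Codes.** A code in $\rho$ is an $R$-submodule $C\le V$; $C^\perp=\{x\in V\mid\beta(x,c)=0\ \forall c\in C\}$; $C$ is self-dual if $C=C^\perp$; a code $C\subseteq C^\perp$ is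 isotropic if $\rho_\Phi(\phi)(C)=\{0\}$ for all $\phi\in\Phi$. A code of Type $\rho$ is a self-dual isotropic code in $\rho$. **The representation $\rho^{(N,N)}$.** This is the finite representation of $(R,\Phi)$ on $V^{2N}=V^N\times V^N$ in which $\rho_M(m)$, $\rho_\Phi(\phi)$, $\beta$ are replaced by the orthogonal sums of $N$ copies of the original and $N$ copies of its negative, e.g. the quadratic maps are $(x,y)\mapsto\sum_{i=1}^N\rho_\Phi(\phi)(x_i)-\sum_{i=1}^N\rho_\Phi(\phi)(y_i)$ and the form is $((x,y),(x',y'))\mapsto\sum_{i=1}^N\beta(x_i,x'_i)-\sum_{i=1}^N\beta(y_i,y_i')$. **Clifford-Weil group.** An idempotent $\iota\in R$ is symmetric if $\iota R\cong\iota^JR$ as right $R$-modules; then one fixes $v_\iota\in\iota^JR\iota$, $u_\iota\in\iota R\iota^J$ with $u_\iota v_\iota=\iota$, $v_\iota u_\iota=\iota^J$. For a finite representation $\rho$ on $V$, let $\mathbb CV$ have basis $(b_w:w\in V)$. The Clifford-Weil group $\mathcal C(\rho)$ is the group of linear operators on $\mathbb CV$ generated by $m_r:b_w\mapsto b_{rw}$ ($r\in R^\times$), $d_\phi:b_w\mapsto\exp(2\pi i\rho_\Phi(\phi)(w))\,b_w$ ($\phi\in\Phi$), and $h_{\iota,u_\iota,v_\iota}:b_w\mapsto|\iota V|^{-1/2}\sum_{u\in\iota V}\exp(2\pi i\beta(u,v_\iota w))\,b_{u+(1-\iota)w}$, where $\iota$ runs through representatives of the $R^\times$-conjugacy classes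 of symmetric idempotents of $R$. **Weight Enumerator Conjecture.** For a code $C$ in $\rho$ let $\mathrm{fwe}(C)=\sum_{c\in C}b_c\in\mathbb CV$. The Weight Enumerator Conjecture holds for $(R,\Phi)$ if for every finite representation $\rho'$ of $(R,\Phi)$, with underlying module $V'$, the subspace of $\mathbb CV'$ fixed by $\mathcal C(\rho')$ is spanned by the $\mathrm{fwe}(C)$, $C$ a code of Type $\rho'$. **The map $\varphi$.** Put $W_N=\mathbb CV^N=\otimes^N\mathbb CV$ (group algebra of $V^N$, basis $b_x$, $x\in V^N$) and $W_N^*=\mathrm{Hom}(W_N,\mathbb C)$ with dual basis $b_y^*$. Let $\varphi:W_N\otimes W_N^*\to\mathrm{End}_{\mathbb C}(W_N)$ be the isomorphism $w\otimes f\mapsto(x\mapsto f(x)w)$. For a code $C\le V^N\times V^N$ in $\rho^{(N,N)}$, $\mathrm{fwe}^{(N,N)}(C)=\sum_{(x,y)\in C}b_{(x,y)}$ is regarded as the element $\sum_{(x,y)\in C}b_x\otimes b_y^*$ of $W_N\otimes W_N^*$. *)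

(* Defs.v *)
From HB Require Import structures.
From mathcomp Require Import all_boot all_order all_algebra.
From mathcomp Require Import boolp reals trigo complex.

Set Implicit Arguments.
Unset Strict Implicit.
Unset Printing Implicit Defensive.

Import Order.TTheory GRing.Theory Num.Theory.
Local Open Scope ring_scope.

Definition biadditive (A B C : zmodType) (f : A -> B -> C) : Prop :=
  (forall b, {morph f^~ b : x y / x + y}) /\
  (forall a, {morph f a : x y / x + y}).

Definition pointed_quadratic (A B : zmodType) (q : A -> B) : Prop :=
  q 0 = 0 /\ biadditive (fun x y => q (x + y) - q x - q y).

Definition int_rat : {pred rat} := fun q => q \is a Num.int.

Fact int_rat_closed : zmod_closed int_rat.
Proof. exact: (GRing.subring_closedB (@int_num_subring rat)). Qed.

HB.instance Definition _ := GRing.isZmodClosed.Build rat int_rat int_rat_closed.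

Definition QZ : zmodType := {ideal_quot int_rat}.

(* A right (R (x)_Z R)-module, presented through the action of the pure
   tensors: by the universal property of R (x)_Z R, a ring morphism from
   (R (x)_Z R)^op to End_Z(M) is the same as a biadditive, unital and
   multiplicative family of endomorphisms m |-> m (r (x) s).
   [tact m r s] is m (r (x) s). *)
Record tmodType (R : pzRingType) := TMod {
  tmod_sort :> zmodType;
  tact : tmod_sort -> R -> R -> tmod_sort;
  tactD : forall r s, {morph (fun m => tact m r s) : m n / m + n};
  tact_biadditive : forall m, biadditive (tact m);
  tact1 : forall m, tact m 1 1 = m;
  tactM : forall m r s r' s',
    tact m (r * r') (s * s') = tact (tact m r s) r' s' }.

(* [qact phi r] is phi[r]; quadraticity of r |-> [r] in End(Phi) is stated
   pointwise. *)
Record qmodType (R : pzRingType) := QMod {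
  qmod_sort :> zmodType;
  qact : qmod_sort -> R -> qmod_sort;
  qactD : forall r, {morph qact^~ r : phi chi / phi + chi};
  qact_quadratic : forall phi, pointed_quadratic (qact phi);
  qact1 : forall phi, qact phi 1 = phi;
  qactM : forall phi r s, qact phi (r * s) = qact (qact phi r) s }.

Definition is_unit (R : pzRingType) (x : R) : Prop :=
  exists y, x * y = 1 /\ y * x = 1.

(* [fbrace] is the map {{ }} : M -> Phi; [psiV] is the inverse of psi, so that
   [tau_unit] says that psi^-1 (tau (psi 1)) is a unit. *)
Record formRing (R : pzRingType) := FormRing {
  frM : tmodType R;
  frPhi : qmodType R;
  psi : {additive R -> frM};
  psiV : frM -> R;
  psi_mulr : forall r s, psi (r * s) = tact (psi r) 1 s;
  psiK : cancel psi psiV;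
  psiVK : cancel psiV psi;
  tau : {additive frM -> frM};
  tauK : involutive tau;
  tau_swap : forall m r s, tact (tau m) s r = tau (tact m r s);
  tau_unit : is_unit (psiV (tau (psi 1)));
  fbrace : {additive frM -> frPhi};
  fbrace_qmod : forall m r, fbrace (tact m r r) = qact (fbrace m) r;
  lambda : {additive frPhi -> frM};
  lambda_qmod : forall phi r, lambda (qact phi r) = tact (lambda phi) r r;
  fbrace_tau : forall m, fbrace (tau m) = fbrace m;
  tau_lambda : forall phi, tau (lambda phi) = lambda phi;
  lambda_fbrace : forall m, lambda (fbrace m) = m + tau m;
  fbrace_lambda : forall phi r s,
    fbrace (tact (lambda phi) r s)
    = qact phi (r + s) - qact phi r - qact phi s }.

Arguments psiV {R} _ _.

Definition frJ (R : pzRingType) (F : formRing R) (r : R) : R :=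
  psiV F (tact (psi F 1) r 1).

(* The library's [finLmodType R] requires R to be nontrivial; [finModType R]
   is the type of finite left modules over an arbitrary unital ring. *)
HB.mixin Record hasFinScale (R : pzRingType) V of FinRing.Zmodule V := {
  fscale : R -> V -> V;
  fscaleA : forall a b v, fscale a (fscale b v) = fscale (a * b) v;
  fscale1 : left_id 1 fscale;
  fscaleDr : right_distributive fscale +%R;
  fscaleDl : forall v, {morph fscale^~ v : a b / a + b} }.

#[short(type="finModType")]
HB.structure Definition FinMod (R : pzRingType) :=
  { V of hasFinScale R V & FinRing.Zmodule V }.

HB.instance Definition _ (R : pzRingType) (V : finModType R) :=
  GRing.Zmodule_isLmodule.Build R (FinMod.sort V)
    (@fscaleA R V) (@fscale1 R V) (@fscaleDr R V) (@fscaleDl R V).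

HB.instance Definition _ (V W : finZmodType) := GRing.Zmodule.on (V * W)%type.
HB.instance Definition _ (I : finType) (V : finZmodType) :=
  GRing.Zmodule.on {ffun I -> V}.

HB.instance Definition _ (R : pzRingType) (V W : finModType R) :=
  @hasFinScale.Build R (V * W)%type *:%R (@scalerA _ _) (@scale1r _ _)
    (@scalerDr _ _) (fun v a b => scalerDl v a b).
HB.instance Definition _ (R : pzRingType) (I : finType) (V : finModType R) :=
  @hasFinScale.Build R {ffun I -> V} *:%R (@scalerA _ _) (@scale1r _ _)
    (@scalerDr _ _) (fun v a b => scalerDl v a b).

(* x |-> b(x, -) is an isomorphism from V onto Hom(V, Q/Z). *)
Definition nonsingular (V : zmodType) (b : V -> V -> QZ) : Prop :=
  (forall x x', b x =1 b x' -> x = x') /\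
  (forall f : V -> QZ, {morph f : y z / y + z} -> exists x, b x =1 f).

Record finRep (R : pzRingType) (F : formRing R) := FinRep {
  repV :> finModType R;
  rhoM : frM F -> repV -> repV -> QZ;
  rhoPhi : frPhi F -> repV -> QZ;
  rhoM_biadditive : forall m, biadditive (rhoM m);
  rhoMD : forall x y, {morph (fun m => rhoM m x y) : m n / m + n};
  rhoM_act : forall m r s x y,
    rhoM (tact m r s) x y = rhoM m (r *: x) (s *: y);
  rhoM_tau : forall m x y, rhoM (tau F m) x y = rhoM m y x;
  rhoM_nonsingular : nonsingular (rhoM (psi F 1));
  rhoPhi_quadratic : forall phi, pointed_quadratic (rhoPhi phi);
  rhoPhiD : forall x, {morph rhoPhi^~ x : phi chi / phi + chi};
  rhoPhi_act : forall phi r x, rhoPhi (qact phi r) x = rhoPhi phi (r *: x);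
  rhoPhi_fbrace : forall m x, rhoPhi (fbrace F m) x = rhoM m x x;
  rhoM_lambda : forall phi x y,
    rhoM (lambda F phi) x y
    = rhoPhi phi (x + y) - rhoPhi phi x - rhoPhi phi y }.

Arguments rhoM {R F} rho m x y : rename.
Arguments rhoPhi {R F} rho phi x : rename.

Definition beta (R : pzRingType) (F : formRing R) (rho : finRep F) :
  rho -> rho -> QZ := rhoM rho (psi F 1).

Section Codes.
Variables (R : pzRingType) (F : formRing R) (rho : finRep F).
Implicit Type C : {set rho}.

Definition is_code C : Prop := submod_closed C.

Definition dual_code C : {set rho} :=
  [set x | [forall c in C, beta x c == 0]].

Definition isotropic C : Prop :=
  C \subset dual_code C /\ forall phi c, c \in C -> rhoPhi rho phi c = 0.

Definition code_of_type C : Prop :=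
  [/\ is_code C, C = dual_code C & isotropic C].

End Codes.

Section DoubleRep.
Variables (R : pzRingType) (F : formRing R) (rho : finRep F) (N : nat).

Definition nnV : finModType R :=
  ({ffun 'I_N -> rho} * {ffun 'I_N -> rho})%type.

Definition nn_rhoM (m : frM F) (p q : nnV) : QZ :=
  \sum_i rhoM rho m (p.1 i) (q.1 i) - \sum_i rhoM rho m (p.2 i) (q.2 i).

Definition nn_rhoPhi (phi : frPhi F) (p : nnV) : QZ :=
  \sum_i rhoPhi rho phi (p.1 i) - \sum_i rhoPhi rho phi (p.2 i).

Let sumBD (f g f' g' : 'I_N -> QZ) :
  \sum_i (f i + g i) - \sum_i (f' i + g' i)
  = (\sum_i f i - \sum_i f' i) + (\sum_i g i - \sum_i g' i).
Proof. by rewrite !big_split /= opprD addrACA. Qed.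

Fact nn_rhoM_biadditive m : biadditive (nn_rhoM m).
Proof.
have [Dl Dr] := rhoM_biadditive rho m.
split=> [q p p'|p q q']; rewrite /nn_rhoM -sumBD; congr (_ - _);
  by apply: eq_bigr => i _; rewrite /= !ffunE ?Dl ?Dr.
Qed.

Fact nn_rhoMD p q : {morph (fun m => nn_rhoM m p q) : m n / m + n}.
Proof.
by move=> m n; rewrite /nn_rhoM -sumBD; congr (_ - _);
  apply: eq_bigr => i _; rewrite rhoMD.
Qed.

Fact nn_rhoM_act m r s p q :
  nn_rhoM (tact m r s) p q = nn_rhoM m (r *: p) (s *: q).
Proof.
by congr (_ - _); apply: eq_bigr => i _; rewrite rhoM_act /= !ffunE.
Qed.

Fact nn_rhoM_tau m p q : nn_rhoM (tau F m) p q = nn_rhoM m q p.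
Proof. by congr (_ - _); apply: eq_bigr => i _; rewrite rhoM_tau. Qed.

Fact nn_rhoM_nonsingular : nonsingular (nn_rhoM (psi F 1)).
Proof.
have [b_inj b_surj] := rhoM_nonsingular rho; set b := rhoM rho _ in b_inj b_surj.
have [Dl Dr] : biadditive b := rhoM_biadditive rho _.
have b0r x : b x 0 = 0 by apply: (addIr (b x 0)); rewrite -Dr !add0r.
pose e i y : {ffun 'I_N -> rho} := [ffun j => if j == i then y else 0].
have eD i : {morph e i : y z / y + z}.
  by move=> y z; apply/ffunP=> j; rewrite !ffunE; case: ifP; rewrite ?addr0.
have sum_e (x : {ffun 'I_N -> rho}) : x = \sum_i e i (x i).
  apply/ffunP=> j; rewrite sum_ffunE (bigD1 j) //= ffunE eqxx big1 ?addr0 //.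
  by move=> i /negPf ne; rewrite ffunE eq_sym ne.
have sum_be (x : {ffun 'I_N -> rho}) i y : \sum_j b (x j) (e i y j) = b (x i) y.
  rewrite (bigD1 i) //= ffunE eqxx big1 ?addr0 // => j /negPf ne.
  by rewrite ffunE ne b0r.
have sum_b0 (x : {ffun 'I_N -> rho}) :
    \sum_j b (x j) ((0 : {ffun 'I_N -> rho}) j) = 0.
  by rewrite big1 // => j _; rewrite ffunE b0r.
split=> [p p' eq_pp' | f fD].
  case: p p' eq_pp' => [p1 p2] [p1' p2'] eq_pp'.
  congr (_, _); apply/ffunP=> i; apply: b_inj => y.
    have /= := eq_pp' (e i y, 0); rewrite /nn_rhoM /= -/b.
    by rewrite !sum_be !sum_b0 !subr0.
  have /= := eq_pp' (0, e i y); rewrite /nn_rhoM /= -/b.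
  by rewrite !sum_be !sum_b0 !sub0r => /oppr_inj.
have f0 : f 0 = 0 by apply: (addIr (f 0)); rewrite -fD !add0r.
have fsum (g : 'I_N -> nnV) : f (\sum_i g i) = \sum_i f (g i).
  exact: (big_morph f fD f0).
have /fin_all_exists [x1 x1P] i : exists x, b x =1 (fun y => f (e i y, 0)).
  by apply: b_surj => y z; rewrite -fD eD; congr f; congr (_, _); rewrite /= addr0.
have /fin_all_exists [x2 x2P] i : exists x, b x =1 (fun y => - f (0, e i y)).
  apply: b_surj => y z; rewrite -opprD -fD eD; congr (- f _).
  by congr (_, _); rewrite /= addr0.
exists (finfun x1, finfun x2) => -[y1 y2]; rewrite /nn_rhoM /= -/b.
have -> : (y1, y2) = \sum_i (e i (y1 i), 0) + \sum_i (0, e i (y2 i)) :> nnV.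
  apply: injective_projections => /=.
    by rewrite !(raddf_sum (@fst _ _)) /= big1_eq addr0 -sum_e.
  by rewrite !(raddf_sum (@snd _ _)) /= big1_eq add0r -sum_e.
rewrite fD !fsum -sumrN; congr (_ + _); apply: eq_bigr => i _.
  by rewrite ffunE x1P.
by rewrite ffunE x2P opprK.
Qed.

Fact nn_rhoPhi_polar phi p q :
  nn_rhoPhi phi (p + q) - nn_rhoPhi phi p - nn_rhoPhi phi q
  = nn_rhoM (lambda F phi) p q.
Proof.
have polar_sum (x y : {ffun 'I_N -> rho}) :
    \sum_i rhoM rho (lambda F phi) (x i) (y i)
    = \sum_i rhoPhi rho phi ((x + y) i)
      - (\sum_i rhoPhi rho phi (x i) + \sum_i rhoPhi rho phi (y i)).
  rewrite -big_split -sumrB; apply: eq_bigr => i _.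
  by rewrite rhoM_lambda ffunE opprD addrA.
rewrite /nn_rhoM !polar_sum /nn_rhoPhi /=.
rewrite -addrA -opprD [X in _ - X]addrACA -opprD [X in _ + X]opprD.
by rewrite addrACA -opprD.
Qed.

Fact nn_rhoPhi_quadratic phi : pointed_quadratic (nn_rhoPhi phi).
Proof.
split.
  by rewrite /nn_rhoPhi !big1 ?subr0 // => i _; rewrite /= ffunE;
    case: (rhoPhi_quadratic rho phi).
have [Dl Dr] := nn_rhoM_biadditive (lambda F phi).
by split=> [q p p'|p q q']; rewrite !nn_rhoPhi_polar ?Dl ?Dr.
Qed.

Fact nn_rhoPhiD p : {morph nn_rhoPhi^~ p : phi chi / phi + chi}.
Proof.
by move=> m n; rewrite /nn_rhoPhi -sumBD; congr (_ - _);
  apply: eq_bigr => i _; rewrite rhoPhiD.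
Qed.

Fact nn_rhoPhi_act phi r p : nn_rhoPhi (qact phi r) p = nn_rhoPhi phi (r *: p).
Proof.
by congr (_ - _); apply: eq_bigr => i _; rewrite rhoPhi_act /= !ffunE.
Qed.

Fact nn_rhoPhi_fbrace m p : nn_rhoPhi (fbrace F m) p = nn_rhoM m p p.
Proof. by congr (_ - _); apply: eq_bigr => i _; rewrite rhoPhi_fbrace. Qed.

Fact nn_rhoM_lambda phi p q :
  nn_rhoM (lambda F phi) p q
  = nn_rhoPhi phi (p + q) - nn_rhoPhi phi p - nn_rhoPhi phi q.
Proof. by rewrite nn_rhoPhi_polar. Qed.

Definition repNN : finRep F :=
  FinRep nn_rhoM_biadditive nn_rhoMD nn_rhoM_act nn_rhoM_tau
    nn_rhoM_nonsingular nn_rhoPhi_quadratic nn_rhoPhiD nn_rhoPhi_act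
    nn_rhoPhi_fbrace nn_rhoM_lambda.

End DoubleRep.

Section SymIdem.
Variables (R : pzRingType) (F : formRing R).

Definition in_rideal (a x : R) : Prop := exists r, x = a * r.

(* aR and bR are isomorphic as right R-modules; only the values of f on aR
   matter. *)
Definition rideal_isom (a b : R) : Prop :=
  exists f : R -> R,
    [/\ forall x, in_rideal a x -> in_rideal b (f x),
        forall x y, in_rideal a x -> in_rideal a y -> f (x + y) = f x + f y,
        forall x r, in_rideal a x -> f (x * r) = f x * r,
        forall x y, in_rideal a x -> in_rideal a y -> f x = f y -> x = y &
        forall y, in_rideal b y -> exists2 x, in_rideal a x & f x = y].

Definition sym_idem (i : R) : Prop := i * i = i /\ rideal_isom i (frJ F i).

Definition conj_idem (i j : R) : Prop :=
  exists r s, [/\ r * s = 1, s * r = 1 & j = r * i * s].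

(* A choice of representatives of the R^*-conjugacy classes of symmetric
   idempotents, together with the elements u_i and v_i fixed for each of
   them. *)
Record symIdemReps := SymIdemReps {
  sreps : R -> Prop;
  su : R -> R;
  sv : R -> R;
  sreps_sym : forall i, sreps i -> sym_idem i;
  sreps_conj : forall j, sym_idem j -> exists! i, sreps i /\ conj_idem i j;
  su_in : forall i, sreps i -> exists r, su i = i * r * frJ F i;
  sv_in : forall i, sreps i -> exists r, sv i = frJ F i * r * i;
  suv : forall i, sreps i -> su i * sv i = i;
  svu : forall i, sreps i -> sv i * su i = frJ F i }.

End SymIdem.

(* exp(2 pi i q), computed on a rational representative [repr q] of q; the
   value does not depend on the representative. *)
Definition expQZ (K : realType) (q : QZ) : K[i] :=
  (cos (2 * pi * ratr (repr q)) +i* sin (2 * pi * ratr (repr q)))%C.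

(* CV, a formal combination of elements of V being its coefficient function. *)
Notation CSpace K V := {ffun V -> K[i]^o}.

Section LinearOperators.
Variable K : realType.

Definition cb (V : finType) (w : V) : CSpace K V := [ffun x => (x == w)%:R].

(* The linear extension of b_w |-> g w. *)
Definition basis_op (V : finType) (g : V -> CSpace K V) : 'End(CSpace K V) :=
  linfun (fun z : CSpace K V => \sum_w z w *: g w).

Definition fwe (V : finType) (C : {set V}) : CSpace K V := \sum_(c in C) cb c.

(* The group generated by a set S of invertible operators. *)
Inductive generated (V : finType) (S : 'End(CSpace K V) -> Prop) :
    'End(CSpace K V) -> Prop :=
| gen_in g : S g -> generated S g
| gen_1 : generated S \1%VF
| gen_mul g h : generated S g -> generated S h -> generated S (g \o h)%VF
| gen_inv g h : generated S g -> (g \o h)%VF = \1%VF -> (h \o g)%VF = \1%VF ->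
    generated S h.

(* g^{(x)N} acting on CV^N, where b_x stands for b_{x_1} (x) ... (x) b_{x_N}. *)
Definition tensor_op (V : finType) (N : nat) (g : 'End(CSpace K V)) :
    'End(CSpace K {ffun 'I_N -> V}) :=
  basis_op (fun x : {ffun 'I_N -> V} =>
    [ffun y : {ffun 'I_N -> V} => \prod_i g (cb (x i)) (y i)]).

Definition dual_cb (W : finType) (y : W) : 'Hom(CSpace K W, K[i]^o) :=
  linfun (fun z : CSpace K W => z y).

Definition rank_one (W : finType) (w : CSpace K W)
    (f : 'Hom(CSpace K W, K[i]^o)) : 'End(CSpace K W) :=
  linfun (fun z => f z *: w).

(* The map W (x) W^* -> End(W), with W (x) W^* identified with C[X x X], where X
   is the given basis of W, through b_{(x,y)} = b_x (x) b_y^*. *)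
Definition varphi (X : finType) (t : CSpace K (X * X)%type) :
    'End(CSpace K X) :=
  \sum_p t p *: rank_one (cb p.1) (dual_cb p.2).

End LinearOperators.

Section CliffordWeil.
Variables (K : realType) (R : pzRingType) (F : formRing R).
Variables (S : symIdemReps F) (rho : finRep F).

Definition op_m (r : R) : 'End(CSpace K rho) :=
  basis_op (fun w : rho => cb K (r *: w)).

Definition op_d (phi : frPhi F) : 'End(CSpace K rho) :=
  basis_op (fun w : rho => expQZ K (rhoPhi rho phi w) *: cb K w).

Definition idem_image (i : R) : {set rho} := [set i *: x | x : rho].

Definition op_h (i v : R) : 'End(CSpace K rho) :=
  basis_op (fun w : rho => (sqrtC #|idem_image i|%:R)^-1 *:
    \sum_(u in idem_image i)
      expQZ K (beta u (v *: w)) *: cb K (u + (1 - i) *: w)).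

Inductive cw_generator : 'End(CSpace K rho) -> Prop :=
| cw_m r : is_unit r -> cw_generator (op_m r)
| cw_d phi : cw_generator (op_d phi)
| cw_h i : sreps S i -> cw_generator (op_h i (sv S i)).

Definition clifford_weil : 'End(CSpace K rho) -> Prop := generated cw_generator.

Definition commutes_with_cw (N : nat) (f : 'End(CSpace K {ffun 'I_N -> rho})) :
    Prop :=
  forall g, clifford_weil g -> (f \o tensor_op N g = tensor_op N g \o f)%VF.

End CliffordWeil.

Definition codes_of_type (R : pzRingType) (F : formRing R) (rho : finRep F) :
  {set {set rho}} := [set C | `[< code_of_type C >]].

Definition weight_enumerator_conjecture (K : realType) (R : pzRingType)
    (F : formRing R) (S : symIdemReps F) : Prop :=
  forall (rho : finRep F) (z : CSpace K rho),
    (forall g, clifford_weil S g -> g z = z) <->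
    z \in <<[seq fwe K C | C <- enum (codes_of_type rho)]>>%VS.

(* Main.v *)
(** Idea: the isomorphism [varphi] turns the Clifford-Weil group of the double
    representation into conjugation.  For each generator [g] attached to [rho],
    the corresponding generator attached to [repNN rho N] is
    [G (x) conj G], where [G] is the [N]-th tensor power of [g]: the sign in
    the second half of the double representation conjugates the exponentials.
    Hence it sends [t] to [t'] with [varphi t' = G (varphi t) G^*], and since
    [G] is unitary, [t] is fixed if and only if [varphi t] commutes with [G].
    The fixed space is spanned by the weight enumerators by assumption. *)

From HB Require Import structures.
Require Import Defs.
From mathcomp Require Import all_boot all_order all_algebra.
From mathcomp Require Import ring lra.
From mathcomp Require Import boolp reals trigo complex.

Set Implicit Arguments.
Unset Strict Implicit.
Unset Printing Implicit Defensive.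

Import Order.TTheory GRing.Theory Num.Theory.
Local Open Scope ring_scope.

(** * The character [expQZ] of Q/Z: multiplicativity, conjugation, triviality of its kernel *)

Section Character.
Variable K : realType.

Local Notation pQ := (\pi_({ideal_quot int_rat})%qT : rat -> QZ).

Lemma cos_sin_intDpi (x : K) (n : int) :
  cos (x + 2 * pi * n%:~R) = cos x /\ sin (x + 2 * pi * n%:~R) = sin x.
Proof.
have nat_case (m : nat) (y : K) :
    cos (y + 2 * pi * m%:R) = cos y /\ sin (y + 2 * pi * m%:R) = sin y.
  rewrite mulr_natr mulr_natl.
  by rewrite (periodicn (@cosD2pi K)) (periodicn (@sinD2pi K)).
case: n => m; first exact: nat_case.
(* For a negative multiple, the natural case is applied at the shifted point, moving it back to
   [x]. *)
have [<- <-] := nat_case m.+1 (x + 2 * pi * (Negz m)%:~R).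
by rewrite NegzE mulrNz mulrN pmulrn subrK.
Qed.

(** The chosen representative of the class of [q] differs from [q] by an integer, which the period
    absorbs. Every later computation with [expQZ] can thus use a convenient representative. *)
Lemma expQZ_pi (q : rat) :
  expQZ K (pQ q)
  = (cos (2 * pi * ratr q : K) +i* sin (2 * pi * ratr q : K))%C.
Proof.
have /intrP[n eq_n] : repr (pQ q) - q \is a Num.int.
  have := Quotient.idealrBE int_rat (repr (pQ q)) q.
  by rewrite reprK eqxx.
have -> : expQZ K (pQ q) = (cos (2 * pi * ratr q + 2 * pi * n%:~R : K)
    +i* sin (2 * pi * ratr q + 2 * pi * n%:~R : K))%C.
  by rewrite -mulrDr -(ratr_int K n) -eq_n -rmorphD addrC subrK.
by have [-> ->] := cos_sin_intDpi (2 * pi * ratr q) n.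
Qed.

Lemma expQZ0 : expQZ K 0 = 1.
Proof. by rewrite -[0](raddf0 pQ) expQZ_pi raddf0 mulr0 cos0 sin0. Qed.

Lemma expQZD : {morph expQZ K : a b / a + b >-> a * b}.
Proof.
move=> a b; rewrite -[a]reprK -[b]reprK -raddfD !expQZ_pi rmorphD mulrDr.
by rewrite cosD sinD; congr (_ +i* _)%C; rewrite addrC [X in X + _]mulrC addrC.
Qed.

Lemma expQZN a : expQZ K (- a) = (expQZ K a)^*.
Proof.
by rewrite -[a]reprK -raddfN !expQZ_pi raddfN mulrN cosN sinN.
Qed.

Lemma expQZ_sum (I : finType) (a : I -> QZ) :
  expQZ K (\sum_i a i) = \prod_i expQZ K (a i).
Proof. exact: (big_morph _ expQZD expQZ0). Qed.

(** Take the representative [q] in [0, 1). If [q] were positive, then pi q would lie strictly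
    between 0 and pi, where the sine is positive; but cos (2 pi q) = 1 forces sin (pi q) = 0 by the
    double-angle formula. *)
Lemma expQZ_eq1 a : expQZ K a = 1 -> a = 0.
Proof.
pose q := repr a - (Num.floor (repr a))%:~R.
have aE : a = pQ q.
  rewrite -[LHS]reprK; apply/eqP; rewrite -Quotient.idealrBE /q opprB addrC.
  by rewrite subrK; apply/intrP; exists (Num.floor (repr a)).
have /andP[q0 q1] : 0 <= q < 1.
  have /andP[le_r lt_r] := floor_itv (repr a).
  by rewrite subr_ge0 le_r ltrBlDl -[X in _ + X]/(1%:~R) -intrD.
rewrite aE expQZ_pi => -[cos1 _].
move: q0; rewrite le_eqVlt => /predU1P[<-|q0]; first exact: raddf0.
have := @sin_gt0_pi K (pi * ratr q).
rewrite mulr_gt0 ?pi_gt0 ?ltr0q //= gtr_pMr ?pi_gt0 //.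
rewrite -[X in _ < X](rmorph1 (@ratr K)) ltr_rat q1.
move=> /(_ isT); rewrite lt_def => /andP[/eqP[]].
move: cos1; rewrite -mulrA mulr_natl cos_mulr2n.
have := cos2Dsin2 (pi * ratr q : K).
by nra.
Qed.

End Character.

(* [entry] and [adjoint] are locked, and the operators made opaque, because
   unfolding them in failed matches is prohibitively expensive. *)
HB.lock Definition entry (K : realType) (V : finType)
  (g : 'End(CSpace K V)) (x y : V) : K[i] := g (cb K y) x.

HB.lock Definition adjoint (K : realType) (V : finType)
  (g : 'End(CSpace K V)) : 'End(CSpace K V) :=
  basis_op (fun y => [ffun x => (entry g y x)^*]).

(** * Matrix entries, adjoints, tensor powers, and [varphi] as conjugation *)

Section Entries.
Variable K : realType.

Lemma cbE (V : finType) (w x : V) : cb K w x = (x == w)%:R.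
Proof. by rewrite ffunE. Qed.

Lemma cb_sum (V : finType) (z : CSpace K V) : z = \sum_w z w *: cb K w.
Proof.
apply/ffunP=> x; rewrite sum_ffunE (bigD1 x) // -[LHS]/(z x).
rewrite [X in _ = X + _]ffunE cbE eqxx big1 => [|w /negPf ne].
  by rewrite addr0; exact: esym (mulr1 _).
by rewrite ffunE cbE eq_sym ne; exact: scaler0.
Qed.

Lemma apply_entry (V : finType) (g : 'End(CSpace K V)) (z : CSpace K V) x :
  g z x = \sum_w entry g x w * z w.
Proof.
rewrite {1}[z]cb_sum linear_sum sum_ffunE; apply: eq_bigr => w _.
by rewrite linearZ ffunE entry.unlock mulrC.
Qed.

Lemma entryP (V : finType) (g h : 'End(CSpace K V)) :
  (forall x y, entry g x y = entry h x y) -> g = h.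
Proof.
move=> eq_gh; apply/lfunP=> z; apply/ffunP=> x; rewrite !apply_entry.
by apply: eq_bigr => w _; rewrite eq_gh.
Qed.

Lemma entry_comp (V : finType) (g h : 'End(CSpace K V)) x y :
  entry (g \o h)%VF x y = \sum_w entry g x w * entry h w y.
Proof.
rewrite {1}entry.unlock lfunE /= apply_entry; apply: eq_bigr => w _.
by rewrite entry.unlock.
Qed.

Lemma entry1 (V : finType) (x y : V) :
  entry (\1%VF : 'End(CSpace K V)) x y = (x == y)%:R.
Proof. by rewrite entry.unlock lfunE ffunE. Qed.

(** [linfun] is applied to bare functions in the definitions, while [lfunE] wants a bundled linear
    map; the bundle is built here from the proof of linearity. *)
Lemma linfun_apply (U W : vectType K[i]) (f : U -> W) z :
  linear f -> linfun f z = f z.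
Proof.
move=> lin; pose m := GRing.isLinear.Build _ _ _ _ f lin.
by pose L : {linear U -> W} := HB.pack f m; rewrite -[LHS]/(linfun L z) lfunE.
Qed.

Lemma basis_op_cb (V : finType) (g : V -> CSpace K V) w :
  basis_op g (cb K w) = g w.
Proof.
rewrite linfun_apply => [|a y z]; last first.
  rewrite scaler_sumr -big_split; apply: eq_bigr => v _ /=.
  by rewrite !ffunE scalerDl scalerA.
rewrite (bigD1 w) //= ffunE eqxx scale1r.
by rewrite big1 ?addr0 // => v /negPf ne; rewrite ffunE ne scale0r.
Qed.

Lemma entry_basis_op (V : finType) (g : V -> CSpace K V) x y :
  entry (basis_op g) x y = g y x.
Proof. by rewrite entry.unlock basis_op_cb. Qed.

Lemma entry_tensor (V : finType) N (g : 'End(CSpace K V)) x y :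
  entry (tensor_op N g) x y = \prod_i entry g (x i) (y i).
Proof. by rewrite entry_basis_op ffunE entry.unlock. Qed.

Lemma prod_eqb (I : finType) (V : eqType) (x y : {ffun I -> V}) :
  \prod_i (x i == y i)%:R = (x == y)%:R :> K[i].
Proof.
have [->|/eqP ne] := eqVneq x y; first by rewrite big1 // => i _; rewrite eqxx.
have /existsP[i /negPf nei] : [exists i, x i != y i].
  by apply: contra_notT ne => /existsPn eq; apply/ffunP => i; apply/eqP/negPn.
by rewrite (bigD1 i) //= nei mul0r.
Qed.

Local Opaque tensor_op.

(** Entrywise, this is the expansion of a product of sums into a sum over all functions from the
    indices to [V]. *)
Lemma tensor_op_comp (V : finType) N (g h : 'End(CSpace K V)) :
  tensor_op N (g \o h)%VF = (tensor_op N g \o tensor_op N h)%VF.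
Proof.
apply: entryP => x y; rewrite [RHS]entry_comp [LHS]entry_tensor.
transitivity (\prod_i \sum_v entry g (x i) v * entry h v (y i)).
  by apply: eq_bigr => i _; exact: entry_comp.
rewrite bigA_distr_bigA; apply: eq_bigr => w _.
by rewrite big_split; congr (_ * _); rewrite [RHS]entry_tensor.
Qed.

Lemma tensor_op1 (V : finType) N :
  tensor_op N \1%VF = \1%VF :> 'End(CSpace K {ffun 'I_N -> V}).
Proof.
apply: entryP => x y; rewrite entry_tensor entry1 -prod_eqb.
by apply: eq_bigr => i _; rewrite entry1.
Qed.

Lemma entry_adjoint (V : finType) (g : 'End(CSpace K V)) x y :
  entry (adjoint g) x y = (entry g y x)^*.
Proof. by rewrite adjoint.unlock entry_basis_op ffunE entry.unlock. Qed.

Lemma adjoint_tensor (V : finType) N (g : 'End(CSpace K V)) :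
  adjoint (tensor_op N g) = tensor_op N (adjoint g).
Proof.
apply: entryP => x y; rewrite [LHS]entry_adjoint [RHS]entry_tensor.
rewrite (entry_tensor g) rmorph_prod.
by apply: eq_bigr => i _; rewrite [RHS]entry_adjoint.
Qed.

Definition unitary (V : finType) (g : 'End(CSpace K V)) : Prop :=
  (adjoint g \o g)%VF = \1%VF.

(** A left inverse makes [g] injective, hence invertible in finite dimension, so the left inverse is
    the inverse. *)
Lemma unitaryC (V : finType) (g : 'End(CSpace K V)) :
  unitary g -> (g \o adjoint g)%VF = \1%VF.
Proof.
move=> ug; have kg : lker g == 0%VS.
  apply/lker0P => y z eq_g; have := congr1 (adjoint g) eq_g.
  by rewrite -!comp_lfunE ug !id_lfunE.
have -> : adjoint g = (g^-1)%VF.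
  by rewrite -[LHS](lker0_compfK kg) ug comp_lfun1l.
exact: lker0_compfV.
Qed.

Lemma unitary_tensor (V : finType) N (g : 'End(CSpace K V)) :
  unitary g -> unitary (tensor_op N g).
Proof.
rewrite /unitary adjoint_tensor -tensor_op_comp => ->.
exact: tensor_op1.
Qed.

Lemma entry_varphi (X : finType) (t : CSpace K (X * X)%type) x y :
  entry (varphi t) x y = t (x, y).
Proof.
have term (p : X * X) :
    rank_one (cb K p.1) (dual_cb K p.2) (cb K y) x = ((x, y) == p)%:R.
  case: p => u v; rewrite /rank_one linfun_apply => [|a z z'] /=; last first.
    by rewrite linearP scalerDl scalerA.
  rewrite /dual_cb linfun_apply => [|a z z'] /=; last by rewrite !ffunE.
  by rewrite !ffunE xpair_eqE eq_sym -mulnb natrM mulrC.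
rewrite entry.unlock /varphi sum_lfunE sum_ffunE (bigD1 (x, y)) //=.
rewrite big1 => [|p ne].
  by rewrite addr0 lfunE ffunE (term (x, y)) eqxx; exact: mulr1.
by rewrite lfunE ffunE (term p) eq_sym (negPf ne) scaler0.
Qed.

Lemma varphi_linear (X : finType) : linear (@varphi K X).
Proof.
move=> a s t; rewrite /varphi scaler_sumr -big_split.
by apply: eq_bigr => v _ /=; rewrite !ffunE scalerDl scalerA.
Qed.

HB.instance Definition _ (X : finType) :=
  GRing.isLinear.Build _ _ _ _ (@varphi K X) (@varphi_linear X).

Lemma varphi_inj (X : finType) : injective (@varphi K X).
Proof.
by move=> s t eq_st; apply/ffunP => -[x y]; rewrite -!entry_varphi eq_st.
Qed.

Lemma varphi_surj (X : finType) (f : 'End(CSpace K X)) : exists t, varphi t = f.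
Proof.
exists [ffun p => entry f p.1 p.2].
by apply: entryP => x y; rewrite entry_varphi ffunE.
Qed.

(** The hypothesis says that [H] is the tensor product of [G] with its entrywise conjugate; the
    second factor becomes right multiplication by the adjoint. *)
Lemma varphi_conj (X : finType) (G : 'End(CSpace K X))
    (H : 'End(CSpace K (X * X)%type)) t :
  (forall p q, entry H p q = entry G p.1 q.1 * (entry G p.2 q.2)^*) ->
  varphi (H t) = (G \o varphi t \o adjoint G)%VF.
Proof.
move=> HE; apply: entryP => x y; rewrite entry_varphi apply_entry entry_comp.
under [RHS]eq_bigr do rewrite entry_comp mulr_suml.
rewrite exchange_big pair_bigA; apply: eq_bigr => -[u v] _ /=.
by rewrite HE entry_varphi entry_adjoint mulrAC.
Qed.

Lemma varphi_fixed (X : finType) (G : 'End(CSpace K X))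
    (H : 'End(CSpace K (X * X)%type)) t :
  unitary G ->
  (forall p q, entry H p q = entry G p.1 q.1 * (entry G p.2 q.2)^*) ->
  H t = t <-> (varphi t \o G = G \o varphi t)%VF.
Proof.
move=> uG HE; have vH := varphi_conj t HE; split=> [Ht|com].
  by rewrite -{1}Ht vH -!comp_lfunA uG comp_lfun1r.
by apply: varphi_inj; rewrite vH -com -comp_lfunA unitaryC ?comp_lfun1r.
Qed.

Lemma generated_fixed (V : finType) (S : 'End(CSpace K V) -> Prop) z :
  (forall g, S g -> g z = z) -> forall g, generated S g -> g z = z.
Proof.
move=> Sz g; elim=> {g} [g /Sz // | | g h _ gz _ hz | g h _ gz _ hg].
- exact: id_lfunE.
- by rewrite comp_lfunE hz gz.
- by rewrite -{1}gz -comp_lfunE hg id_lfunE.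
Qed.

Lemma comm_inverse (U : vectType K[i]) (f a b : 'End(U)) :
  (f \o a = a \o f)%VF -> (a \o b = \1)%VF -> (b \o a = \1)%VF ->
  (f \o b = b \o f)%VF.
Proof.
move=> fa ab ba; rewrite -[LHS]comp_lfun1l -ba -comp_lfunA (comp_lfunA a) -fa.
by rewrite -(comp_lfunA f) ab comp_lfun1r.
Qed.

(** The tensor power respects products and the identity, so it carries mutually inverse operators to
    mutually inverse operators; [comm_inverse] then settles the case of inverses. *)
Lemma generated_comm (V : finType) (S : 'End(CSpace K V) -> Prop) N
    (f : 'End(CSpace K {ffun 'I_N -> V})) :
  (forall g, S g -> (f \o tensor_op N g = tensor_op N g \o f)%VF) ->
  forall g, generated S g -> (f \o tensor_op N g = tensor_op N g \o f)%VF.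
Proof.
move=> Sf g; elim=> {g} [g /Sf // | | g h _ gf _ hf | g h _ gf gh hg].
- by rewrite tensor_op1 comp_lfun1l comp_lfun1r.
- by rewrite tensor_op_comp comp_lfunA gf -!comp_lfunA hf.
- have Tgh : (tensor_op N g \o tensor_op N h)%VF = \1%VF.
    by rewrite -tensor_op_comp gh tensor_op1.
  have Thg : (tensor_op N h \o tensor_op N g)%VF = \1%VF.
    by rewrite -tensor_op_comp hg tensor_op1.
  exact: comm_inverse gf Tgh Thg.
Qed.

End Entries.

(** * Unitarity of the three kinds of generators *)

Section Generators.
Variables (K : realType) (R : pzRingType) (F : formRing R) (rho : finRep F).

Lemma entry_op_m (r : R) (x y : rho) :
  entry (op_m K rho r) x y = (x == r *: y)%:R.
Proof. by rewrite entry_basis_op cbE. Qed.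

Lemma entry_op_d phi (x y : rho) :
  entry (op_d K rho phi) x y = expQZ K (rhoPhi rho phi y) * (x == y)%:R.
Proof. by rewrite entry_basis_op ffunE cbE. Qed.

Lemma mem_idem_image (i : R) (x : rho) :
  i * i = i -> (x \in idem_image rho i) = (i *: x == x).
Proof.
move=> ii; apply/imsetP/eqP => [[y _ ->]|<-]; last by exists x.
by rewrite scalerA ii.
Qed.

(** Since V is the direct sum of iV and (1 - i)V, the equation x = u + (1 - i)y with u in iV has at
    most the solution u = ix, and has it exactly when the components of x and y in (1 - i)V
    agree. *)
Lemma entry_op_h (i v : R) (x y : rho) : i * i = i ->
  entry (op_h K rho i v) x y
  = (sqrtC #|idem_image rho i|%:R)^-1 *
    (((1 - i) *: x == (1 - i) *: y)%:R * expQZ K (beta (i *: x) (v *: y))).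
Proof.
move=> ii; rewrite entry_basis_op ffunE sum_ffunE.
congr (_ * _).
have memE (u : rho) : (u \in idem_image rho i) && (x == u + (1 - i) *: y)
    = ((1 - i) *: x == (1 - i) *: y) && (u == i *: x).
  have i1i (z : rho) : i *: ((1 - i) *: z) = 0.
    by rewrite scalerA mulrBr mulr1 ii subrr scale0r.
  have split_i (z : rho) : z = i *: z + (1 - i) *: z.
    by rewrite -scalerDl addrC subrK scale1r.
  rewrite mem_idem_image //; apply/andP/andP => -[/eqP e1 /eqP e2].
    have ix : i *: x = u by rewrite e2 scalerDr i1i addr0.
    by split; apply/eqP => //; apply: (addrI u); rewrite -{1}ix -split_i.
  by rewrite e2 scalerA ii -e1 -split_i.
under eq_bigr => u _ do rewrite ffunE cbE.
rewrite (eq_bigr (fun u => if x == u + (1 - i) *: y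
    then expQZ K (beta u (v *: y)) else 0)) => [|u _]; last first.
  by case: ifP => _; [exact: mulr1 | exact: mulr0].
rewrite -big_mkcondr (eq_bigl _ _ memE); case: eqP => _ /=; last first.
  by rewrite mul0r big_pred0.
by rewrite mul1r big_pred1_eq.
Qed.

Local Opaque op_m op_d op_h.

(** Both sides are compared in [frM F], where the actions of the tensors s (x) 1 and 1 (x) [frJ F r]
    commute. *)
Lemma frJ_mul r s : frJ F (r * s) = frJ F s * frJ F r.
Proof.
have psi_J t : psi F (frJ F t) = tact (psi F 1) t 1 by rewrite psiVK.
rewrite -[RHS](psiK F) psi_mulr psi_J -tactM mulr1 mul1r.
rewrite -[in RHS](mul1r s) -[in RHS](mulr1 (frJ F r)) tactM -psi_mulr mul1r.
by rewrite psi_J -tactM mulr1.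
Qed.

Lemma beta_frJ r (x y : rho) : beta (r *: x) y = beta x (frJ F r *: y).
Proof.
rewrite -{1}[y]scale1r -[x in RHS]scale1r /beta -!rhoM_act -psi_mulr mul1r.
by rewrite psiVK.
Qed.

(** [nonsingular] gives injectivity in the first argument only. Exchanging the arguments of [beta]
    inserts the factor psi^-1 (tau (psi 1)), a unit with inverse [e], so [e *: y] is orthogonal to
    everything from the left. *)
Lemma beta_right_nondeg (y : rho) : (forall x : rho, beta x y = 0) -> y = 0.
Proof.
move=> y0; have [e [fe ef]] := tau_unit F.
have beta_tau (x z : rho) : beta z x = beta x (psiV F (tau F (psi F 1)) *: z).
  rewrite /beta -rhoM_tau -[x in RHS]scale1r -rhoM_act -psi_mulr mul1r.
  by rewrite psiVK.
have ey0 : e *: y = 0.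
  apply: (rhoM_nonsingular rho).1 => x.
  have [Dl _] := rhoM_biadditive rho (psi F 1).
  rewrite -/(beta _ _) beta_tau scalerA fe scale1r y0.
  by apply: (addIr (rhoM rho (psi F 1) 0 x)); rewrite -Dl !add0r.
by rewrite -[y]scale1r -fe -scalerA ey0 scaler0.
Qed.

Lemma unitary_op_m r : is_unit r -> unitary (op_m K rho r).
Proof.
move=> [s [rs sr]]; apply: entryP => x y; rewrite [LHS]entry_comp [RHS]entry1.
rewrite (bigD1 (r *: x)) //= entry_adjoint !entry_op_m eqxx rmorph1 mul1r.
rewrite big1 ?addr0 => [|w /negPf ne]; last first.
  by rewrite entry_adjoint entry_op_m ne rmorph0 mul0r.
have rK : cancel ( *:%R r) ( *:%R s : rho -> rho).
  by move=> z; rewrite scalerA sr scale1r.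
by rewrite (can_eq rK).
Qed.

Lemma unitary_op_d phi : unitary (op_d K rho phi).
Proof.
apply: entryP => x y; rewrite [LHS]entry_comp [RHS]entry1.
rewrite (bigD1 x) //= entry_adjoint !entry_op_d eqxx mulr1.
rewrite big1 ?addr0 => [|w /negPf ne]; last first.
  by rewrite entry_adjoint entry_op_d ne mulr0 rmorph0 mul0r.
case: eqP => [<-|_]; last by rewrite !mulr0.
by rewrite mulr1 -expQZN -expQZD addNr expQZ0.
Qed.

(** Orthogonality of characters: translating by [k0] preserves the sum, yet multiplies it by a
    number different from 1. *)
Lemma sum_expQZ0 (V : finZmodType) (A : {pred V}) (a : V -> QZ) k0 :
    {morph a : x y / x + y} -> (forall k, (k + k0 \in A) = (k \in A)) ->
  a k0 != 0 -> \sum_(k in A) expQZ K (a k) = 0.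
Proof.
move=> aD Ak0 ak0; set S := \sum_(k in A) _.
have SE : S = S * expQZ K (a k0).
  rewrite {1}/S (reindex (+%R^~ k0)) /=; last first.
    by apply: onW_bij; exists (+%R^~ (- k0)) => k; rewrite ?addrK ?subrK.
  by rewrite mulr_suml; apply: eq_big => // k _; rewrite aD expQZD.
have /eqP : S * (expQZ K (a k0) - 1) = 0 by rewrite mulrBr -SE mulr1 subrr.
rewrite mulf_eq0 subr_eq0 => /orP[/eqP // | /eqP /expQZ_eq1 e].
by rewrite e eqxx in ak0.
Qed.

(** An entry of the product with the adjoint is, up to the normalization, a character sum over a
    coset of iV, or zero if [x] and [y] differ in (1 - i)V. The character is trivial for x = y;
    otherwise it is nontrivial on iV and the sum vanishes. *)
Lemma unitary_op_h (i u v : R) : i * i = i -> frJ F i * v = v -> u * v = i ->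
  unitary (op_h K rho i v).
Proof.
move=> ii Jv uv; apply: entryP => x y; rewrite [LHS]entry_comp [RHS]entry1.
set n := #|idem_image rho i|.
have n_gt0 : (0 < n)%N.
  by apply/card_gt0P; exists 0; rewrite mem_idem_image // scaler0.
have [bDl bDr] := rhoM_biadditive rho (psi F 1).
have b0 (z : rho) : beta z 0 = 0.
  by apply: (addIr (beta z 0)); rewrite /beta -bDr !add0r.
have bB (z t t' : rho) : beta z (t - t') = beta z t - beta z t'.
  by apply: (addIr (beta z t')); rewrite /beta -bDr !subrK.
(* Moving [i] across the form gives [frJ F i], which [v] absorbs. *)
have bi (z t : rho) : beta (i *: z) (v *: t) = beta z (v *: t).
  by rewrite beta_frJ scalerA Jv.
have i1i : i * (1 - i) = 0 by rewrite mulrBr mulr1 ii subrr.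
have ii1 : (1 - i) * (1 - i) = 1 - i by rewrite mulrBl mul1r i1i subr0.
pose b (z w : rho) := (1 - i) *: z == (1 - i) *: w.
pose c : K[i] := (sqrtC n%:R)^-1.
have cc : c^* * c = n%:R^-1.
  have c_real : c^* = c.
    by apply: geC0_conj; rewrite invr_ge0 sqrtC_ge0 ler0n.
  by rewrite c_real -expr2 exprVn sqrtCK.
transitivity (\sum_w n%:R^-1 * ((b w x && b w y)%:R *
    expQZ K (beta w (v *: (y - x)))) : K[i]).
  apply: eq_bigr => w _; rewrite entry_adjoint !entry_op_h // -/n -/c -/(b w x).
  rewrite -/(b w y) !rmorphM rmorph_nat /= -expQZN !bi scalerBr bB expQZD.
  by rewrite -cc -mulnb natrM; ring.
rewrite -mulr_sumr; have [bxy|nbxy] := boolP (b x y); last first.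
  rewrite big1 ?mulr0 => [|w _].
    by case: (x =P y) nbxy => // ->; rewrite /b eqxx.
  have -> : b w x && b w y = false.
    by apply: contraNF nbxy => /andP[/eqP wx]; rewrite /b -wx.
  by rewrite mul0r.
pose d := y - x.
have id : (1 - i) *: d = 0 by rewrite scalerBr (eqP bxy) subrr.
(* This translation carries iV onto the coset of the admissible [w]; by [bi], the shift contributes
   nothing to the exponent. *)
rewrite (reindex (+%R^~ ((1 - i) *: x))) /=; last first.
  apply: onW_bij; exists (+%R^~ (- ((1 - i) *: x))) => k;
  by rewrite ?addrK ?subrK.
rewrite (eq_bigr (fun k => if k \in idem_image rho i
    then expQZ K (beta k (v *: d)) else 0)) => [|k _]; last first.
  rewrite /b -(eqP bxy) andbb scalerDr scalerA ii1 -[X in _ == X]add0r.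
  rewrite (inj_eq (addIr _)) mem_idem_image // scalerBl scale1r subr_eq0 eq_sym.
  rewrite /beta bDl -/(beta _ _) -/(beta (_ *: x) _) -(bi (_ *: x)) scalerA i1i.
  rewrite scale0r; have -> : beta (0 : rho) (v *: (y - x)) = 0.
    by apply: (addIr (beta 0 (v *: (y - x)))); rewrite /beta -bDl !add0r.
  by rewrite addr0; case: ifP => _; rewrite ?mul1r ?mul0r.
rewrite -big_mkcond; case: eqP => [exy|nxy] /=.
  rewrite (eq_bigr (fun=> 1)) => [|k _].
    by rewrite sumr_const mulVf // pnatr_eq0 -lt0n.
  by rewrite /d exy subrr scaler0 b0 expQZ0.
(* The difference [d] lies in iV, on which [v] is injective because u v = i. Thus v d is nonzero and
   right nondegeneracy supplies [k0]. *)
have [k0 bk0] : exists k0 : rho, beta k0 (v *: d) <> 0.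
  apply/not_existsP => all0; apply: nxy.
  have vd : v *: d = 0.
    by apply: beta_right_nondeg => k; apply: contrapT; exact: all0.
  apply/eqP; rewrite eq_sym -subr_eq0 -/d -[d]scale1r -(subrK i 1) scalerDl id.
  by rewrite -uv -scalerA vd scaler0 addr0.
rewrite (@sum_expQZ0 rho _ _ (i *: k0)) ?mulr0 // => [z t|k|].
- exact: bDl.
- rewrite !mem_idem_image // scalerDr scalerA ii.
  by rewrite (inj_eq (addIr _)).
- by apply/eqP; rewrite bi.
Qed.

End Generators.

(** * Generators of the double representation as tensor products *)

Section DoubleRepGenerators.
Variables (K : realType) (R : pzRingType) (F : formRing R) (rho : finRep F).
Variable N : nat.

Local Opaque op_m op_d op_h tensor_op.

(** This is the hypothesis of [varphi_fixed] for the tensor power of [g]; pairs are typed as a plain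
    product to match it. *)
Definition tensor_adjoint_entries (g : 'End(CSpace K rho))
    (g' : 'End(CSpace K (repNN rho N))) : Prop :=
  forall p q : {ffun 'I_N -> rho} * {ffun 'I_N -> rho},
  entry g' p q
  = entry (tensor_op N g) p.1 q.1 * (entry (tensor_op N g) p.2 q.2)^*.

Lemma nn_eqb (p q : repNN rho N) :
  (p == q)%:R = (p.1 == q.1)%:R * (p.2 == q.2)%:R :> K[i].
Proof. by rewrite -natrM mulnb. Qed.

Lemma expQZ_nn (a b : 'I_N -> QZ) :
  expQZ K (\sum_i a i - \sum_i b i)
  = (\prod_i expQZ K (a i)) * (\prod_i expQZ K (b i))^*.
Proof. by rewrite expQZD expQZN !expQZ_sum. Qed.

Lemma entry_tensor_m r (x y : {ffun 'I_N -> rho}) :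
  entry (tensor_op N (op_m K rho r)) x y = (x == r *: y)%:R.
Proof.
rewrite entry_tensor -prod_eqb; apply: eq_bigr => i _.
by rewrite entry_op_m ffunE.
Qed.

Lemma tensor_adjoint_m r :
  tensor_adjoint_entries (op_m K rho r) (op_m K (repNN rho N) r).
Proof.
move=> p q; rewrite !entry_tensor_m rmorph_nat.
by rewrite (entry_op_m K r (p : repNN rho N)) nn_eqb.
Qed.

Lemma entry_tensor_d phi (x y : {ffun 'I_N -> rho}) :
  entry (tensor_op N (op_d K rho phi)) x y
  = (\prod_i expQZ K (rhoPhi rho phi (y i))) * (x == y)%:R.
Proof.
rewrite entry_tensor -prod_eqb -big_split; apply: eq_bigr => i _.
by rewrite entry_op_d.
Qed.

Lemma tensor_adjoint_d phi :
  tensor_adjoint_entries (op_d K rho phi) (op_d K (repNN rho N) phi).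
Proof.
move=> p q; rewrite !entry_tensor_d rmorphM rmorph_nat.
rewrite (entry_op_d K phi (p : repNN rho N)) nn_eqb expQZ_nn /=.
by rewrite mulrACA.
Qed.

(** Lying in the image of an idempotent is a fixed-point condition, hence can be tested on each
    coordinate. *)
Lemma card_idem_image_nn i : i * i = i ->
  #|idem_image (repNN rho N) i|
  = (#|idem_image rho i| ^ N * #|idem_image rho i| ^ N)%N.
Proof.
move=> ii; pose A : {set {ffun 'I_N -> rho}} :=
  [set x in ffun_on (mem (idem_image rho i))].
have AE x : (x \in A) = (i *: x == x).
  rewrite inE; apply/ffun_onP/eqP => [xA|ix j].
    by apply/ffunP => j; rewrite ffunE; apply/eqP; rewrite -mem_idem_image ?xA.
  by rewrite mem_idem_image // -{2}ix ffunE.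
have cardA : #|A| = (#|idem_image rho i| ^ N)%N.
  by rewrite cardsE card_ffun_on card_ord.
rewrite -cardA -cardsX; apply: eq_card => p.
by rewrite mem_idem_image // inE !AE.
Qed.

Lemma entry_tensor_h i v (x y : {ffun 'I_N -> rho}) : i * i = i ->
  entry (tensor_op N (op_h K rho i v)) x y
  = (sqrtC #|idem_image rho i|%:R)^-1 ^+ N *
    (((1 - i) *: x == (1 - i) *: y)%:R *
     \prod_j expQZ K (beta (i *: x j) (v *: y j))).
Proof.
move=> ii; rewrite entry_tensor -prod_eqb.
set c := (sqrtC _)^-1; have -> : c ^+ N = \prod_(j < N) c.
  by rewrite prodr_const card_ord.
rewrite -!big_split; apply: eq_bigr => j _.
by rewrite entry_op_h // !ffunE.
Qed.

Lemma tensor_adjoint_h i v : i * i = i ->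
  tensor_adjoint_entries (op_h K rho i v) (op_h K (repNN rho N) i v).
Proof.
move=> ii p q; rewrite !entry_tensor_h // !rmorphM rmorph_nat.
rewrite (entry_op_h K v (p : repNN rho N)) // nn_eqb card_idem_image_nn //.
set n := #|idem_image rho i|; pose c : K[i] := (sqrtC n%:R)^-1.
have c_real : (c ^+ N)^* = c ^+ N.
  by apply: geC0_conj; rewrite exprn_ge0 // invr_ge0 sqrtC_ge0 ler0n.
(* The normalizing factor splits evenly between the two halves; being real, its second copy is
   unchanged by conjugation. *)
have -> : (sqrtC (n ^ N * n ^ N)%:R)^-1 = c ^+ N * c ^+ N :> K[i].
  rewrite natrM -expr2 sqrCK ?ler0n // -exprMn -expr2 exprVn sqrtCK natrX.
  by rewrite exprVn.
have -> : expQZ K (beta (i *: (p : repNN rho N)) (v *: (q : repNN rho N)))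
    = (\prod_j expQZ K (beta (i *: p.1 j) (v *: q.1 j)))
      * (\prod_j expQZ K (beta (i *: p.2 j) (v *: q.2 j)))^*.
  rewrite -expQZ_nn; congr expQZ; congr (_ - _);
  by apply: eq_bigr => j _; rewrite /= !ffunE.
have shuffle (a b b' d d' : K[i]) :
    a * a * (b * b' * (d * d')) = a * (b * d) * (a * (b' * d')) by ring.
by rewrite -/c [X in _ = _ * (X * _)]c_real; exact: shuffle.
Qed.

End DoubleRepGenerators.

(** * From generators to the full group, and the spanning statement *)

Lemma unitary_sreps (K : realType) (R : pzRingType) (F : formRing R)
    (S : symIdemReps F) (rho : finRep F) i : sreps S i ->
  i * i = i /\ unitary (op_h K rho i (sv S i)).
Proof.
move=> Si; have [ii _] := sreps_sym Si; split=> //.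
have [r vE] := sv_in Si.
apply: (unitary_op_h K rho ii _ (suv Si)).
by rewrite vE !mulrA -frJ_mul ii.
Qed.

Lemma mem_span_linear_inj (K : fieldType) (U W : vectType K)
    (f : {linear U -> W}) (s : seq U) t : injective f ->
  (f t \in <<[seq f u | u <- s]>>%VS) = (t \in <<s>>%VS).
Proof.
move=> f_inj; rewrite -(eq_map (lfunE f)) -limg_span -(lfunE f).
apply/memv_imgP/idP => [[u us]|ts]; last by exists t.
by rewrite !lfunE => /f_inj ->.
Qed.

Theorem theorem8p1 (K : realType) (R : pzRingType) (F : formRing R)
    (S : symIdemReps F) (hWEC : weight_enumerator_conjecture K S)
    (rho : finRep F) (N : nat) (hN : (1 <= N)%N)
    (Cs : seq {set repNN rho N})
    (hCs : forall C, C \in Cs <-> code_of_type C)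
    (f : 'End(CSpace K {ffun 'I_N -> rho})) :
  f \in <<[seq varphi (fwe K C) | C <- Cs]>>%VS <-> commutes_with_cw S f.
Proof.
have [t <-] := varphi_surj f.
(* Membership is pulled back along the injective [varphi]. The order and repetitions in [Cs] are
   harmless, since a span depends only on the set of listed vectors. *)
have -> : (varphi t \in <<[seq varphi (fwe K C) | C <- Cs]>>%VS)
    = (t \in <<[seq fwe K C | C <- enum (codes_of_type (repNN rho N))]>>%VS).
  rewrite -(mem_span_linear_inj _ t (@varphi_inj K _)) -map_comp.
  set s := map _ Cs; set s' := map _ _.
  suff ss' : s =i s' by rewrite (eq_span ss').
  move=> u; apply/mapP/mapP => -[C CC ->]; exists C => //.
    by rewrite mem_enum inE; apply/asboolP/hCs.
  by apply/hCs/asboolP; move: CC; rewrite mem_enum inE.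
(* This equivalence for a single generator serves both directions; [generated_comm] and
   [generated_fixed] extend it to the groups. *)
have generatorP g g' : unitary g -> tensor_adjoint_entries g g' ->
    g' t = t <-> (varphi t \o tensor_op N g = tensor_op N g \o varphi t)%VF.
  by move=> /(unitary_tensor N) ug gg'; exact: varphi_fixed.
have [fixed_span span_fixed] := hWEC (repNN rho N) t.
split=> [/span_fixed fixed_t|comm_t].
  apply: generated_comm => g [r ur|phi|i Si].
  - apply/(generatorP _ _ (unitary_op_m _ _ ur) (tensor_adjoint_m _ r)).
    exact/fixed_t/gen_in/cw_m.
  - apply/(generatorP _ _ (unitary_op_d _ _ phi) (tensor_adjoint_d _ phi)).
    exact/fixed_t/gen_in/cw_d.
  - have [ii uh] := unitary_sreps K rho Si.
    apply/(generatorP _ _ uh (tensor_adjoint_h _ _ ii)).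
    exact/fixed_t/gen_in/cw_h.
apply/fixed_span/generated_fixed => g [r ur|phi|i Si].
- apply/(generatorP _ _ (unitary_op_m _ _ ur) (tensor_adjoint_m _ r)).
  exact/comm_t/gen_in/cw_m.
- apply/(generatorP _ _ (unitary_op_d _ _ phi) (tensor_adjoint_d _ phi)).
  exact/comm_t/gen_in/cw_d.
- have [ii uh] := unitary_sreps K rho Si.
  apply/(generatorP _ _ uh (tensor_adjoint_h _ _ ii)).
  exact/comm_t/gen_in/cw_h.
Qed.
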